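(* Let $G\subset\mathrm{Br}(X)$ be endowed with the total order $<$ defined in the context. There exists a unique subset $\mathcal{B}^\star\subset G\subset\mathrm{Br}(X)$ which, ordered by the restriction of $<$, is a Hall set.
   Context: Brackets. Let $X=\{X_0,X_1\}$. $\mathrm{Br}(X)$ is the free magma over $X$: $X_0,X_1\in\mathrm{Br}(X)$ and the ordered pair $(a,b)\in\mathrm{Br}(X)$ whenever $a,b\in\mathrm{Br}(X)$. $n_1(b)$ is the number of occurrences of $X_1$ in $b$. For $b=(b_1,b_2)$, $\lambda(b)=b_1$ and $\mu(b)=b_2$. For $\nu\in\mathbb{N}$, $b0^\nu:=(\cdots((b,X_0),X_0)\cdots,X_0)$ with $X_0$ appended $\nu$ times. Hall set. A Hall set is a subset $\mathcal{B}\subset\mathrm{Br}(X)$ totally ordered by a relation $<$ such that: (i) $X\subset\mathcal{B}$; (ii) for $b=(b_1,b_2)\in\mathrm{Br}(X)$, $b\in\mathcal{B}$ iff $b_1,b_2\in\mathcal{B}$, $b_1<b_2$ and either $b_2\in X$ or $\lambda(b_2)\le b_1$; (iii) for all $b_1,b_2\in\mathcal{B}$ with $(b_1,b_2)\in\mathcal{B}$, $b_1<(b_1,b_2)$. The set $G$ and its order. $G\subset\mathrm{Br}(X)$ is the smallest subset with $X_0,X_1\in G$ and $(a,b)\in G$ whenever $a,b\in G$, $a\ne X_0$. Every $b\in G\setminus\{X_0\}$ is uniquely written $b=b^*0^{\nu_b}$ with $\nu_b\in\mathbb{N}$, $b^*\in G$, and either $b^*=X_1$ or $b^*=(b_1,b_2)$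 with $b_1\ne X_0$, $b_2\ne X_0$; $b^*$ is the germ of $b$; let $G^*\subset G$ be the set of germs (those $b$ with $b=b^*$). The order on $G$ is defined recursively by: (B0) $X_0$ is the maximal element; (B1) for $a,b\in G\setminus\{X_0\}$, $a<b$ iff $a^*<b^*$, or $a^*=b^*$ and $\nu_a<\nu_b$; (B2) for $a^*,b^*\in G^*$, $a^*<b^*$ iff $n_1(a^* )<n_1(b^* )$, or $n_1(a^* )=n_1(b^* )$ and $\lambda(a^* )<\lambda(b^* )$, or $n_1(a^* )=n_1(b^* )$, $\lambda(a^* )=\lambda(b^* )$ and $\mu(a^* )<\mu(b^* )$. *)

(* Defs.v *)
From HB Require Import structures.
From mathcomp Require Import all_boot.
From mathcomp Require Import boolp classical_sets.

Set Implicit Arguments.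
Unset Strict Implicit.
Unset Printing Implicit Defensive.

Local Open Scope classical_set_scope.

(* The free magma Br(X) over X = {X0, X1}. *)
Inductive br : Type :=
| X0 : br
| X1 : br
| Pair : br -> br -> br.

Definition br_comparable : comparable br.
Proof. by move=> a b; rewrite /decidable; decide equality. Defined.

HB.instance Definition _ := hasDecEq.Build br (compareP br_comparable).

Definition letters : set br := [set X0; X1].

Fixpoint n1 (b : br) : nat :=
  match b with
  | X0 => 0
  | X1 => 1
  | Pair b1 b2 => n1 b1 + n1 b2
  end.

(* The factors lambda and mu are meaningful on pairs only; the value on a
   letter is a dummy. *)
Definition lambda (b : br) : br := if b is Pair b1 _ then b1 else b.
Definition mu (b : br) : br := if b is Pair _ b2 then b2 else b.

Definition app0 (b : br) (v : nat) : br := iter v (fun c => Pair c X0) b.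

Definition strict_total_order_on (T : Type) (A : set T) (lt : T -> T -> Prop) :=
  [/\ forall x, A x -> ~ lt x x,
      forall x y z, A x -> A y -> A z -> lt x y -> lt y z -> lt x z
    & forall x y, A x -> A y -> [\/ lt x y, x = y | lt y x]].

(* Every clause only compares elements of B: in [hall_pair], lambda b2 lies in
   B as soon as b2 does and is not a letter. *)
Record hall_set (B : set br) (lt : br -> br -> Prop) : Prop := HallSet {
  hall_order : strict_total_order_on B lt;
  hall_letters : letters `<=` B;
  hall_pair : forall b1 b2, B (Pair b1 b2) <->
    [/\ B b1, B b2, lt b1 b2
      & letters b2 \/ (lambda b2 = b1 \/ lt (lambda b2) b1)];
  hall_lt : forall b1 b2, B b1 -> B b2 -> B (Pair b1 b2) ->
    lt b1 (Pair b1 b2)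
}.

Inductive G : br -> Prop :=
| G_X0 : G X0
| G_X1 : G X1
| G_pair a b : G a -> G b -> a <> X0 -> G (Pair a b).

(* The germ b^* and the exponent nu_b; see [germ_nu] and [germ_nu_uniq]. *)
Fixpoint germ (b : br) : br := if b is Pair b' X0 then germ b' else b.
Fixpoint nu (b : br) : nat := if b is Pair b' X0 then (nu b').+1 else 0.

Definition germ_shape (b : br) : Prop :=
  b = X1 \/ exists b1 b2, [/\ b = Pair b1 b2, b1 <> X0 & b2 <> X0].

Definition Gstar : set br := [set b | [/\ G b, b <> X0 & germ b = b]].

(* X0 is maximal; other elements are compared by germ, then by exponent. Germs
   are compared by n1, then lambda, then mu: this is inlined here to make the
   recursion structural, and recovered as the equivalences [ltG_B1] and
   [ltG_B2]. The values outside of G are irrelevant; on G this is a strict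
   total order, [ltG_total_order]. *)
Fixpoint ltG (a b : br) {struct a} : bool :=
  if a == X0 then false
  else if b == X0 then true
  else
    [|| n1 (germ a) < n1 (germ b),
        (n1 (germ a) == n1 (germ b)) &&
        match germ a, germ b with
        | Pair a1 a2, Pair b1 b2 => ltG a1 b1 || (a1 == b1) && ltG a2 b2
        | _, _ => false
        end
      | (germ a == germ b) && (nu a < nu b)].

Lemma germ_nu (b : br) : b = app0 (germ b) (nu b).
Proof. by elim: b => //= a IHa [] //= _; rewrite -IHa. Qed.

Lemma n1_gt0 (b : br) : G b -> b <> X0 -> 0 < n1 b.
Proof.
by elim=> {b} //= a b _ IHa _ _ aX0 _; rewrite (leq_trans (IHa aX0)) ?leq_addr.
Qed.

Lemma germ_in_Gstar (b : br) : G b -> b <> X0 -> Gstar (germ b).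
Proof.
elim=> {b} // [|a b Ga IHa Gb _ aX0 _]; first by move=> _; split => //; exact: G_X1.
by case: b Gb => [|//|//] Gb /=; [exact: IHa|split=> //; exact: G_pair..].
Qed.

Fixpoint br_size (b : br) : nat :=
  if b is Pair b1 b2 then (br_size b1 + br_size b2).+1 else 1.

Lemma br_size_germ (b : br) : br_size (germ b) <= br_size b.
Proof.
by elim: b => //= c IHc [] //=; rewrite addn1 (leq_trans IHc) // leqW.
Qed.

Lemma GstarP (b : br) : Gstar b ->
  b = X1 \/ exists b1 b2,
    [/\ b = Pair b1 b2, G b1, G b2, b1 <> X0 & b2 <> X0].
Proof.
case=> Gb; case: Gb => [//||a c Ga Gc aX0 _]; first by left.
case: c Gc => [|//|//] Gc gE; right.
- by have := br_size_germ a; rewrite -[germ a]/(germ (Pair a X0)) gE /= addn1 ltnNge leqnSn.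
- by exists a, X1.
- by eexists; eexists; split; first by reflexivity.
Qed.

Lemma Gstar_shape (b : br) : Gstar b -> germ_shape b.
Proof.
by move=> /GstarP[->|[b1 [b2 [-> _ _ ? ?]]]]; [left|right; exists b1, b2].
Qed.

Lemma germ_nu_uniq (b c : br) (v : nat) :
  germ_shape c -> b = app0 c v -> c = germ b /\ v = nu b.
Proof.
move=> cS ->; elim: v => [|v [cE vE]]; last by rewrite /= -vE.
by case: cS => [->//|[b1 [b2 [-> _]]]]; case: b2.
Qed.

Lemma ltG_B0 (a : br) : G a -> a <> X0 -> ltG a X0 /\ ~~ ltG X0 a.
Proof. by case: a. Qed.

Lemma ltGE (a b : br) : a <> X0 -> b <> X0 ->
  ltG a b =
    [|| n1 (germ a) < n1 (germ b),
        (n1 (germ a) == n1 (germ b)) &&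
        match germ a, germ b with
        | Pair a1 a2, Pair b1 b2 => ltG a1 b1 || (a1 == b1) && ltG a2 b2
        | _, _ => false
        end
      | (germ a == germ b) && (nu a < nu b)].
Proof. by case: a => // [_|a1 a2 _] /eqP/negbTE /= ->. Qed.

Lemma Gstar_nu (b : br) : Gstar b -> nu b = 0.
Proof. by move=> /GstarP[->//|[b1 [b2 [-> _ _ _]]]]; case: b2. Qed.

Lemma ltG_B1 (a b : br) : G a -> G b -> a <> X0 -> b <> X0 ->
  ltG a b <-> ltG (germ a) (germ b) \/ germ a = germ b /\ nu a < nu b.
Proof.
move=> Ga Gb aX0 bX0.
have ga := germ_in_Gstar Ga aX0; have gb := germ_in_Gstar Gb bX0.
have [_ gaX0 gaE] := ga; have [_ gbX0 gbE] := gb.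
rewrite (ltGE aX0 bX0) (ltGE gaX0 gbX0) gaE gbE (Gstar_nu ga) (Gstar_nu gb) ltnn andbF orbF.
rewrite orbA; split=> [/orP[l|/andP[/eqP gab l]]|[l|[gab l]]].
- by left.
- by right.
- by rewrite l.
- by rewrite gab l !eqxx orbT.
Qed.

Lemma n1_pair (a b : br) : G a -> G b -> a <> X0 -> b <> X0 ->
  1 < n1 (Pair a b).
Proof. by move=> *; rewrite (@leq_add 1 1) ?n1_gt0. Qed.

Lemma ltG_B2 (a b : br) : Gstar a -> Gstar b ->
  ltG a b <-> [\/ n1 a < n1 b,
                  n1 a = n1 b /\ ltG (lambda a) (lambda b)
                | [/\ n1 a = n1 b, lambda a = lambda b & ltG (mu a) (mu b)]].
Proof.
move=> ga gb; have [_ aX0 aE] := ga; have [_ bX0 bE] := gb.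
rewrite (ltGE aX0 bX0) aE bE (Gstar_nu ga) (Gstar_nu gb) ltnn andbF orbF.
have [aP|[a1 [a2 [aP Ga1 Ga2 a1X a2X]]]] := GstarP ga;
have [bP|[b1 [b2 [bP Gb1 Gb2 b1X b2X]]]] := GstarP gb; rewrite aP bP.
- by split=> // -[|[]|[]].
- have := n1_pair Gb1 Gb2 b1X b2X; set n := n1 _ => n2.
  by rewrite /= n2; split=> // _; constructor 1.
- have := n1_pair Ga1 Ga2 a1X a2X; set n := n1 _ => n2.
  split=> [|[|[]|[]]]; rewrite ?andbF ?orbF /=.
  + by move=> n1; constructor 1.
  + by move=> ->.
  + by move=> nE; rewrite nE in n2.
  + by move=> nE; rewrite nE in n2.
- set n := n1 (Pair a1 _); set m := n1 (Pair b1 _).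
  split=> [/orP[nm|/andP[/eqP nm /orP[l|/andP[/eqP l r]]]]|[->//|[-> /= ->]|[-> /= -> ->]]].
  + by constructor 1.
  + by constructor 2.
  + by constructor 3.
  + by rewrite eqxx orbT.
  + by rewrite !eqxx !orbT.
Qed.

Lemma ltG_irr (a : br) : G a -> ~ ltG a a.
Proof.
have [n] := ubnP (br_size a); elim: n a => // n IHn a sa Ga.
have [->//|/eqP aX0] := eqVneq a X0.
move=> /(ltG_B1 Ga Ga aX0 aX0)[|[_]]; last by rewrite ltnn.
have ga := germ_in_Gstar Ga aX0; have := leq_ltn_trans (br_size_germ a) sa.
move: ga; set c := germ a => ga sc /(ltG_B2 ga ga).
have [cP|[a1 [a2 [cP Ga1 Ga2 _ _]]]] := GstarP ga; rewrite cP in sc *.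
  by case=> [|[]|[]].
move: sc; rewrite /= ltnS => sc.
have s1 : br_size a1 < n by apply: leq_trans sc; rewrite ltnS leq_addr.
have s2 : br_size a2 < n by apply: leq_trans sc; rewrite ltnS leq_addl.
by case=> [|[_]|[_ _]]; [rewrite ltnn|exact: IHn..].
Qed.

Lemma ltG_trichotomy (a b : br) : G a -> G b -> [\/ ltG a b, a = b | ltG b a].
Proof.
have [n] := ubnP (br_size a); elim: n a b => // n IHn a b sa Ga Gb.
have [aE|/eqP aX0] := eqVneq a X0.
  have [->|/eqP bX0] := eqVneq b X0; first by rewrite aE; constructor 2.
  by rewrite aE; constructor 3; have [] := ltG_B0 Gb bX0.
have [->|/eqP bX0] := eqVneq b X0.
  by constructor 1; have [] := ltG_B0 Ga aX0.
have ga := germ_in_Gstar Ga aX0; have gb := germ_in_Gstar Gb bX0.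
have : [\/ ltG (germ a) (germ b), germ a = germ b | ltG (germ b) (germ a)].
  have := leq_ltn_trans (br_size_germ a) sa.
  move: (germ a) (germ b) ga gb => c d ga gb sc.
  have [l|l|nE] := ltngtP (n1 c) (n1 d).
  - by constructor 1; apply/(ltG_B2 ga gb); constructor 1.
  - by constructor 3; apply/(ltG_B2 gb ga); constructor 1.
  have [cP|[c1 [c2 [cP Gc1 Gc2 c1X c2X]]]] := GstarP ga;
  have [dP|[d1 [d2 [dP Gd1 Gd2 d1X d2X]]]] := GstarP gb.
  - by constructor 2; rewrite cP dP.
  - by have := n1_pair Gd1 Gd2 d1X d2X; rewrite -dP -nE cP.
  - by have := n1_pair Gc1 Gc2 c1X c2X; rewrite -cP nE dP.
  rewrite {}cP in ga sc nE *; rewrite {}dP in gb nE *.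
  rewrite /= ltnS in sc.
  have s1 : br_size c1 < n by apply: leq_trans sc; rewrite ltnS leq_addr.
  have s2 : br_size c2 < n by apply: leq_trans sc; rewrite ltnS leq_addl.
  have [l|E1|l] := IHn c1 d1 s1 Gc1 Gd1.
  - by constructor 1; apply/(ltG_B2 ga gb); constructor 2.
  - have [l|E2|l] := IHn c2 d2 s2 Gc2 Gd2.
    + by constructor 1; apply/(ltG_B2 ga gb); constructor 3.
    + by constructor 2; rewrite E1 E2.
    + by constructor 3; apply/(ltG_B2 gb ga); constructor 3.
  - by constructor 3; apply/(ltG_B2 gb ga); constructor 2.
case=> [l|E|l].
- by constructor 1; apply/(ltG_B1 Ga Gb aX0 bX0); left.
- have [l|l|nE] := ltngtP (nu a) (nu b).
  + by constructor 1; apply/(ltG_B1 Ga Gb aX0 bX0); right.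
  + by constructor 3; apply/(ltG_B1 Gb Ga bX0 aX0); right.
  + by constructor 2; rewrite (germ_nu a) (germ_nu b) E nE.
- by constructor 3; apply/(ltG_B1 Gb Ga bX0 aX0); left.
Qed.

Lemma ltG_trans (a b c : br) : G a -> G b -> G c ->
  ltG a b -> ltG b c -> ltG a c.
Proof.
have [n] := ubnP (br_size a); elim: n a b c => // n IHn a b c sa Ga Gb Gc ab bc.
have [aE|/eqP aX0] := eqVneq a X0; first by rewrite aE in ab.
have [bE|/eqP bX0] := eqVneq b X0; first by rewrite bE in bc.
have [->|/eqP cX0] := eqVneq c X0; first by have [] := ltG_B0 Ga aX0.
have ga := germ_in_Gstar Ga aX0; have gb := germ_in_Gstar Gb bX0.
have gc := germ_in_Gstar Gc cX0.
apply/(ltG_B1 Ga Gc aX0 cX0).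
move: ab bc => /(ltG_B1 Ga Gb aX0 bX0) ab /(ltG_B1 Gb Gc bX0 cX0) bc.
case: ab bc => [ab|[-> ab]] [bc|[bcE bc]]; last 1 first.
- by right; rewrite bcE (ltn_trans ab bc).
- left; have := leq_ltn_trans (br_size_germ a) sa.
  move: (germ a) (germ b) (germ c) ga gb gc ab bc => x y z gx gy gz xy yz sx.
  apply/(ltG_B2 gx gz).
  move: xy yz => /(ltG_B2 gx gy) xy /(ltG_B2 gy gz) yz.
  have [xP|[x1 [x2 [xP Gx1 Gx2 x1X x2X]]]] := GstarP gx.
    have xy1 : n1 x < n1 y.
      rewrite {}xP in xy *.
      have [yP|[y1 [y2 [yP Gy1 Gy2 y1X y2X]]]] := GstarP gy.
        by rewrite yP in xy; case: xy => [|[]|[]].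
      by rewrite yP n1_pair.
    by constructor 1; case: yz => [/(ltn_trans xy1)|[<- _]|[<- _ _]].
  have Glm w : Gstar w -> G (lambda w) /\ G (mu w).
    by move=> /GstarP[->|[w1 [w2 [-> ? ? _ _]]]]; split=> //; exact: G_X1.
  have [[Gy1 Gy2] [Gz1 Gz2]] := (Glm y gy, Glm z gz).
  have {}sx : (br_size x1 + br_size x2).+1 <= n by rewrite xP in sx.
  have s1 : br_size (lambda x) < n.
    by rewrite xP; apply: leq_trans sx; rewrite ltnS leq_addr.
  have s2 : br_size (mu x) < n.
    by rewrite xP; apply: leq_trans sx; rewrite ltnS leq_addl.
  have [Gl Gm] := Glm x gx.
  case: xy yz => [xy|[xy lxy]|[xy lxy mxy]] [yz|[yz lyz]|[yz lyz myz]].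
  - by constructor 1; exact: ltn_trans yz.
  - by constructor 1; rewrite -yz.
  - by constructor 1; rewrite -yz.
  - by constructor 1; rewrite xy.
  - by constructor 2; rewrite xy yz; split=> //; exact: IHn lyz.
  - by constructor 2; rewrite xy yz -lyz.
  - by constructor 1; rewrite xy.
  - by constructor 2; rewrite xy yz lxy.
  - by constructor 3; rewrite xy yz lxy lyz; split=> //; exact: IHn myz.
- by left; rewrite -bcE.
- by left.
Qed.

Lemma ltG_total_order : strict_total_order_on G ltG.
Proof.
split; [exact: ltG_irr|exact: ltG_trans|exact: ltG_trichotomy].
Qed.

(* Main.v *)
Require Import Defs.
From mathcomp Require Import all_boot.
From mathcomp Require Import boolp classical_sets.

(** Once the order is fixed, the pair condition of a Hall set decides membership
    of [Pair b1 b2] from the membership of the strictly smaller brackets [b1] and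
    [b2]; since both letters are members, it is a recursive definition.  This
    gives uniqueness at once, by induction on brackets, and leaves a single
    candidate for existence, [hall].  Two facts remain to be checked for it.
    - It lies in [G] ([hall_G]): a member [Pair b1 b2] has [ltG b1 b2], so
      [b1] is not the maximal element [X0].  The total order on [G]
      therefore restricts to it.
    - The left factor of a bracket of [G] is smaller than the bracket
      ([ltG_pair]), because the order compares germs by [n1] first and then
      exponents. *)

Local Open Scope classical_set_scope.

Fixpoint hall (b : br) : Prop :=
  if b is Pair b1 b2 then
    [/\ hall b1, hall b2, ltG b1 b2
      & letters b2 \/ (lambda b2 = b1 \/ ltG (lambda b2) b1)]
  else True.

Lemma strict_total_order_on_subset (T : Type) (A B : set T)
    (lt : T -> T -> Prop) :
  A `<=` B -> strict_total_order_on B lt -> strict_total_order_on A lt.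
Proof.
move=> AB [irr tr tot]; split=> [x /AB|x y z /AB Bx /AB By /AB Bz|x y /AB Bx /AB By].
- exact: irr.
- exact: tr.
- exact: tot.
Qed.

(** Only the condition [a <> X0] on the pairs of [G] needs an argument: it
    follows from the maximality of [X0]. *)
Lemma hall_G : hall `<=` G.
Proof.
elim=> [_|_|b1 IH1 b2 IH2 [h1 h2 lt12 _]]; [exact: G_X0|exact: G_X1|].
by apply: G_pair; [exact: IH1|exact: IH2|move=> b1E; rewrite b1E in lt12].
Qed.

Lemma n1_germ (b : br) : n1 (germ b) = n1 b.
Proof. by elim: b => //= b1 IH1 [|//|//] _ /=; rewrite addn0. Qed.

(** Appending [X0] keeps the germ and raises the exponent; appending another
    element of [G] makes the whole pair a germ, with more occurrences of [X1]. *)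
Lemma ltG_pair (b1 b2 : br) : G b1 -> G b2 -> b1 <> X0 -> ltG b1 (Pair b1 b2).
Proof.
move=> Gb1 Gb2 b1X0; rewrite ltGE //.
have [->|/eqP b2X0] := eqVneq b2 X0; first by rewrite /= !eqxx ltnSn !orbT.
suff -> : n1 (germ b1) < n1 (germ (Pair b1 b2)) by [].
by rewrite !n1_germ -[X in X < _]addn0 ltn_add2l n1_gt0.
Qed.

Lemma hall_set_hall : hall_set hall ltG.
Proof.
split=> // [||b1 b2 /hall_G Gb1 /hall_G Gb2 [_ _ lt12 _]].
- exact: strict_total_order_on_subset hall_G ltG_total_order.
- by move=> b [->|->].
- by apply: ltG_pair => // b1E; rewrite b1E in lt12.
Qed.

(** Two Hall sets for the same relation satisfy the same recursive membership
    condition, with the same value on letters. *)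
Lemma hall_set_unique (lt : br -> br -> Prop) (B C : set br) :
  hall_set B lt -> hall_set C lt -> B = C.
Proof.
move=> HB HC; apply/funext; elim=> [||b1 IH1 b2 IH2].
- by apply/propext; split=> _; [apply: (hall_letters HC)|apply: (hall_letters HB)]; left.
- by apply/propext; split=> _; [apply: (hall_letters HC)|apply: (hall_letters HB)]; right.
- by rewrite (propext (hall_pair HB b1 b2)) (propext (hall_pair HC b1 b2)) IH1 IH2.
Qed.

Theorem theorem3p4 : exists! B : set br, B `<=` G /\ hall_set B ltG.
Proof.
exists hall; split=> [|B [_ HB]].
- by split; [exact: hall_G|exact: hall_set_hall].
- exact: hall_set_unique hall_set_hall HB.
Qed.
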